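(* Let $\kappa>0$, $L>0$, and consider the system $$\frac{d^2 q_n}{dt^2}=\kappa(q_{n+1}-2q_n+q_{n-1})-V'(q_n)$$ on the periodic lattice of $2L$ particles, $-L\le n\le L$, with the soft on-site potential $$V(x)=-\frac{\omega_0^2}{2}x^2+\frac{a}{p+1}x^{p+1},\qquad a>0,\ p>1,$$ where $p$ is an odd integer, so that $V(x)=V(-x)$. Every nontrivial periodic travelling wave solution $q_n(t)=Q(n-ct)=Q(z)$ with speed $c$ satisfying $$c^2>\sqrt{C(L)}\,\bigl(2\kappa+C(L)\,\omega_0^2\bigr)=:c_{\mathrm{crit}}^2$$ must have average kinetic energy $T(Q)=\frac12\int_{-L}^{L}Q'(z)^2\,dz$ satisfying the lower bound $$T_{\mathrm{thresh}}<2\,T(Q),$$ where $$T_{\mathrm{thresh}}:=\left[\frac{c^2-\sqrt{C(L)}\,(2\kappa+C(L)\,\omega_0^2)}{C(L)}\right]^{\frac{2}{p-1}}\left(\frac{1}{p\,a\,C_*^{p-1}}\right)^{\frac{2}{p-1}}.$$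
   Context: The finite lattice consists of oscillators placed equidistantly on an interval of length $2L$ (positions $x_n=-L+nh$, $h=2L/N$, $\kappa=1/2h^2$), with periodic boundary conditions $q_n=q_{n+N}$. A periodic travelling wave solution (TWS) with velocity $c\neq0$ has the form $q_n(t)=Q(n-ct)=Q(z)$ with $Q$ a $2L$-periodic function; it satisfies the advance-delay equation $$c^2Q''(z)=\kappa\,(Q(z+1)-2Q(z)+Q(z-1))-V'(Q(z)).$$ One considers periodic TWSs of zero mean, $\int_{-L}^LQ(z)\,dz=\int_{-L}^LV'(Q(z))\,dz=0$, i.e. performing oscillations about $Q=0$, in the space $\mathcal{X}_1$ of $2L$-periodic $Q\in H^1_{per}(-L,L)$ with $\int_{-L}^LQ\,ds=\int_{-L}^LV'(Q(s))\,ds=0$ and $Q(s-L/2)=-Q(L/2-s)$, with norm $\|Q\|_{\mathcal{X}_1}=\left(\int_{-L}^LQ'(s)^2ds\right)^{1/2}$. Nontrivial means $Q\not\equiv0$. $C(L)=L^2/\pi^2$ is the optimal constant in the Poincaré inequality $\int_{-L}^LQ^2ds\le C(L)\int_{-L}^L(Q')^2ds$ on $\mathcal{X}_1$. $C_*>0$ is the optimal constant of the embedding $\mathcal{X}_1\subset L^\infty(-L,L)$, $\|Q\|_{L^\infty}\le C_*\|Q\|_{\mathcal{X}_1}$. *)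

(* Defs.v *)
From HB Require Import structures.
From mathcomp Require Import all_boot all_order all_algebra.
From mathcomp Require Import all_classical all_reals all_analysis.
Set Implicit Arguments.
Unset Strict Implicit.
Unset Printing Implicit Defensive.
Import Order.TTheory GRing.Theory Num.Theory.
Import numFieldNormedType.Exports.
Local Open Scope ring_scope.
Local Open Scope classical_set_scope.

(* Integral over one period. *)
Definition per_int (R : realType) (L : R) (f : R -> R) : R :=
  \int[@lebesgue_measure R]_(x in `[- L, L]) f x.

Definition smooth (R : realType) (f : R -> R) : Prop :=
  forall (n : nat) (x : R), derivable (f^`(n)%classic) x 1.

Definition square_integrable (R : realType) (L : R) (g : R -> R) : Prop :=
  measurable_fun `[- L, L] g /\
  (@lebesgue_measure R).-integrable `[- L, L] (fun x => (g x ^+ 2)%:E).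

(* [g] is the L^2 weak derivative of the 2L-periodic function [Q]; testing
   against periodic (rather than compactly supported) functions makes the
   derivative that of [Q] on the circle R / 2LZ. *)
Definition weak_derivative (R : realType) (L : R) (Q g : R -> R) : Prop :=
  square_integrable L g /\
  forall phi : R -> R, smooth phi -> periodic phi (2 * L) ->
    per_int L (fun x => Q x * (phi^`()%classic) x) = - per_int L (fun x => g x * phi x).

(* H^1_per(-L, L), each class being identified with its continuous 2L-periodic
   representative on the line (so Q is automatically in L^2). *)
Definition H1per (R : realType) (L : R) (Q : R -> R) : Prop :=
  [/\ continuous Q, periodic Q (2 * L) & exists g, weak_derivative L Q g].

(* The space X_1 of zero-mean antisymmetric profiles. *)
Definition X1 (R : realType) (V : R -> R) (L : R) (Q : R -> R) : Prop :=
  [/\ H1per L Q, per_int L Q = 0, per_int L (fun s => (V^`()%classic) (Q s)) = 0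
    & forall s, Q (s - L / 2) = - Q (L / 2 - s)].

(* The L^oo(-L, L) norm (an essential supremum, in the extended reals). *)
Definition Linfty_norm (R : realType) (L : R) (Q : R -> R) : \bar R :=
  let mu := mrestr (@lebesgue_measure R) (measurable_itv (`]- L, L[)%R) in
  ('N[mu]_(+oo) [EFin \o Q])%E.

(* ||Q||_{L^oo} <= C ||Q||_{X_1} on X_1.  The norm
   ||Q||_{X_1} = (int (Q')^2)^{1/2} is computed from any weak derivative [g];
   it does not depend on the choice of [g], which is unique almost
   everywhere. *)
Definition embedding_bound (R : realType) (V : R -> R) (L C : R) : Prop :=
  forall Q g : R -> R, X1 V L Q -> weak_derivative L Q g ->
    (Linfty_norm L Q <= (C * Num.sqrt (per_int L (fun s => g s ^+ 2)))%:E)%E.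

(* [Cs] is the constant C_*. *)
Definition optimal_embedding_constant (R : realType) (V : R -> R) (L Cs : R) :
    Prop :=
  [/\ 0 < Cs, embedding_bound V L Cs
    & forall C, 0 <= C -> embedding_bound V L C -> Cs <= C].

(* C(L), the optimal constant in the Poincare inequality on X_1. *)
Definition poincare_constant (R : realType) (L : R) : R := L ^+ 2 / pi ^+ 2.

Definition soft_potential (R : realType) (omega0 a : R) (p : nat) (x : R) : R :=
  - (omega0 ^+ 2 / 2) * x ^+ 2 + a / (p%:R + 1) * x ^+ p.+1.

Definition lattice_solution (R : realType) (kappa : R) (V : R -> R)
    (q : int -> R -> R) : Prop :=
  forall (n : int) (t : R),
    [/\ derivable (q n) t 1, derivable ((q n)^`()%classic) t 1
      & ((q n)^`(2)%classic) t =
        kappa * (q (n + 1) t - 2 * q n t + q (n - 1) t) - (V^`()%classic) (q n t)].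

(* The particles are indexed by all integers; periodicity of the lattice,
   q_{n + 2L} = q_n when 2L is the number of particles, is carried by the
   2L-periodicity of the profile [Q]. *)
Definition periodic_travelling_wave (R : realType) (kappa : R) (V : R -> R)
    (L c : R) (Q : R -> R) : Prop :=
  X1 V L Q /\ lattice_solution kappa V (fun n t => Q (n%:~R - c * t)).

Definition kinetic_energy (R : realType) (L : R) (Q : R -> R) : R :=
  2^-1 * per_int L (fun z => (Q^`()%classic) z ^+ 2).

Definition c_crit_sq (R : realType) (kappa omega0 L : R) : R :=
  Num.sqrt (poincare_constant L)
  * (2 * kappa + poincare_constant L * omega0 ^+ 2).

Definition T_thresh (R : realType) (kappa omega0 a : R) (p : nat)
    (L c Cs : R) : R :=
  ((c ^+ 2 - c_crit_sq kappa omega0 L) / poincare_constant L)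
     `^ (2 / (p%:R - 1))
  * (1 / (p%:R * a * Cs ^+ (p - 1))) `^ (2 / (p%:R - 1)).

(* Main.v *)
Require Import Defs.
From HB Require Import structures.
From mathcomp Require Import all_boot all_order all_algebra.
From mathcomp Require Import all_classical all_reals all_analysis.
From mathcomp Require Import ring lra.
Set Implicit Arguments.
Unset Strict Implicit.
Unset Printing Implicit Defensive.
Import Order.TTheory GRing.Theory Num.Theory.
Import numFieldNormedType.Exports.
Local Open Scope ring_scope.
Local Open Scope classical_set_scope.

(** Testing the travelling wave equation against Q and integrating over a period
    turns it into the energy balance
<<
      c^2 int Q'^2 = kappa int (Q(z+1) - Q(z))^2 - omega0^2 int Q^2
                     + a int Q^(p+1).
>>
    Write A = int Q'^2 = 2 T(Q) and r = L / pi, so that the Poincare constant is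
    r^2, and let M = C_* sqrt A bound |Q|.  Then
    Q^(p+1) = Q^(p-1) Q^2 <= M^(p-1) Q^2, and the omega0 term has a favourable
    sign ([energy_estimate]).  The difference term is at most A
    ([per_int_difference_le_deriv]) and at most 4 int Q^2
    ([per_int_difference_le_sqr]), the latter being at most 4 r^2 A; as
    min(1, 4 r^2) <= 2 r, it is at most 2 r A, which is where the linear factor
    sqrt(C(L)) in the critical speed comes from.  Dividing by A > 0 gives
    c^2 <= 2 kappa r + a M^(p-1) r^2, hence
    (c^2 - c_crit^2) / r^2 <= a C_*^(p-1) A^((p-1)/2), and since p > 1 the
    stated bound follows strictly.

    The symmetry condition says that Q is odd, so with periodicity Q vanishes at
    -L, 0 and L; the Poincare inequality thus reduces to the Dirichlet one on
    two intervals of length L ([dirichlet_wirtinger], [poincare]).  The equation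
    makes Q twice differentiable, so that its classical derivative is a weak one
    ([classical_weak_derivative]) to which the embedding bound applies, and an
    essential bound on a continuous function is pointwise
    ([Linfty_norm_pointwise]).

    All integrands are continuous, so each integral is handled as an increment
    of a primitive, and an inequality between integrals as the monotonicity of a
    combination of primitives with nonnegative derivative. *)

(** * Primitives and integrals over a period *)

Lemma continuous_integrable (R : realType) (f : R -> R) (a b : R) :
  continuous f ->
  (@lebesgue_measure R).-integrable `[a, b] (EFin \o f).
Proof.
move=> cf; apply: continuous_compact_integrable; first exact: segment_compact.
exact: continuous_subspaceT.
Qed.

Lemma is_derive_continuous (R : realType) (F f : R -> R) :
  (forall x : R, is_derive x 1 F (f x)) -> continuous F.
Proof.
move=> dF x; apply: differentiable_continuous; apply/derivable1_diffP.
exact: ex_derive.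
Qed.

Lemma continuous_sqr (R : realType) (f : R -> R) :
  continuous f -> continuous (fun x => f x ^+ 2).
Proof. by move=> cf x; apply: continuousM; exact: cf. Qed.

Lemma continuous_translate (R : realType) (f : R -> R) (k : R) :
  continuous f -> continuous (fun x => f (x + k)).
Proof.
move=> cf x; apply: (@continuous_comp _ _ _ (fun x => x + k) f); last exact: cf.
by apply: cvgD; [exact: cvg_id|exact: cvg_cst].
Qed.

Lemma is_derive_translate (R : realType) (F : R -> R) (k x d : R) :
  is_derive (x + k) 1 F d -> is_derive x 1 (fun y => F (y + k)) d.
Proof.
move=> dF; have dk : is_derive x 1 (fun y => y + k) 1.
  by apply: is_derive_eq (is_deriveD _ _) _; rewrite addr0.
by have := @is_derive1_comp R F (fun y => y + k) x d 1 dF dk; rewrite mulr1.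
Qed.

Lemma is_derive_ge0_le (R : realType) (F f : R -> R) (a b : R) :
  (forall x : R, x \in `[a, b]%R -> is_derive x 1 F (f x)) -> a <= b ->
  (forall x : R, x \in `]a, b[%R -> 0 <= f x) -> F a <= F b.
Proof.
move=> dF ab f0.
have dFc x : x \in `]a, b[%R -> is_derive x 1 F (f x).
  by move=> xab; apply: dF; exact: subset_itv_oo_cc.
apply: (@ger0_derive1_le_cc R F a b) => //; rewrite ?in_itv/= ?lexx ?ab//.
- by move=> x /dFc ?; exact: ex_derive.
- by move=> x xab; rewrite derive1E; have ? := dFc _ xab; rewrite derive_val f0.
- by apply: derivable_within_continuous => x /dF ?; exact: ex_derive.
Qed.

Lemma is_derive_0_eq (R : realType) (F : R -> R) :
  (forall x : R, is_derive x 1 F 0) -> forall a b, F a = F b.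
Proof.
move=> dF; suff le_F a b : a <= b -> F a = F b.
  by move=> a b; case/orP: (le_total a b) => /le_F.
move=> ab; apply/le_anti/andP; split.
  by apply: (@is_derive_ge0_le _ F (fun=> 0)).
rewrite -lerN2; apply: (@is_derive_ge0_le _ (- F) (fun=> 0)) => //= x _.
by apply: is_derive_eq (is_deriveN (dF x)) _; rewrite oppr0.
Qed.

(** The primitive is needed on the whole line, whereas the fundamental theorem
    of calculus works to the right of a base point.  Integrating from
    - (|x| + 1), and subtracting the integral from there to 0, gives a function
    that near each point coincides with a primitive taken from a fixed base. *)
Lemma exists_primitive (R : realType) (f : R -> R) :
  continuous f -> exists F : R -> R, forall x : R, is_derive x 1 F (f x).
Proof.
move=> cf; pose mu := @lebesgue_measure R.
have fi a b : mu.-integrable `[a, b] (EFin \o f).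
  exact: continuous_integrable.
pose I a x : R := \int[mu]_(t in `[a, x]) f t.
have IB a b y x : a <= y -> b <= y -> y <= x -> I a x - I a y = I b x - I b y.
  move=> ay by_ yx; rewrite /I.
  by rewrite !(@Rintegral_itvB _ _ _ _ y)// bnd_simp.
pose F x := I (- (`|x| + 1)) x - I (- (`|x| + 1)) 0.
exists F => x; pose a := - (`|x| + 2).
have ax : a < x.
  by rewrite /a ltrNl (le_lt_trans (ler_norm _))// normrN ltrDl.
have [dI eI] : derivable (I a) x 1 /\ (I a)^`() x = f x.
  by apply: (@continuous_FTC1_closed R f a x (x + 1)) => //;
    [rewrite ltrDl|exact: cf].
apply: (@near_eq_is_derive _ _ _ (I a - cst (I a 0))).
  near=> y; have yx : `|y| < `|x| + 1.
    have : ball x 1 y by near: y; exact: nbhsx_ballx.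
    rewrite /ball/= distrC => xy1.
    by rewrite -ltrBlDl (le_lt_trans (lerB_dist _ _)).
  have ab : a <= - (`|y| + 1) by rewrite /a; lra.
  have by_ : - (`|y| + 1) <= y by have := lerNnormlW (lexx `|y|); lra.
  have b0 : - (`|y| + 1) <= 0 by have := normr_ge0 y; lra.
  rewrite /F !fctE/=; case: (leP 0 y) => y0.
    by apply: IB => //; lra.
  apply: oppr_inj; rewrite !opprB; apply: IB; lra.
apply: is_derive_eq (is_deriveB _ _) _; last by rewrite subr0.
by rewrite -eI derive1E; exact/derivableP.
Unshelve. all: by end_near. Qed.

Lemma per_int_primitive (R : realType) (L : R) (F f : R -> R) :
  0 < L -> continuous f -> (forall x : R, is_derive x 1 F (f x)) ->
  per_int L f = F L - F (- L).
Proof.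
move=> L0 cf dF; have cF := is_derive_continuous dF.
rewrite /per_int /Rintegral (@continuous_FTC2 R f F)//.
- by rewrite gtrN.
- exact: continuous_subspaceT.
- split.
  + by move=> x _; exact: ex_derive.
  + exact/cvg_at_right_filter/cF.
  + exact/cvg_at_left_filter/cF.
- by move=> x _; rewrite derive1E derive_val.
Qed.

(** The increment of a primitive over the window [s - L, s + L] has derivative
    f (s + L) - f (s - L) = 0. *)
Lemma per_int_translate (R : realType) (L k : R) (f : R -> R) :
  0 < L -> continuous f -> periodic f (2 * L) ->
  per_int L (fun x => f (x + k)) = per_int L f.
Proof.
move=> L0 cf pf; have [F dF] := exists_primitive cf.
have dFk (x : R) : is_derive x 1 (fun y => F (y + k)) (f (x + k)).
  exact: is_derive_translate.
have cfk := continuous_translate (k := k) cf.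
rewrite (per_int_primitive L0 cf dF) (per_int_primitive L0 cfk dFk).
pose W := (fun s => F (s + L)) - (fun s => F (s - L)).
suff /is_derive_0_eq/(_ k 0) : forall s : R, is_derive s 1 W 0.
  by rewrite /W !fctE !add0r [L + k]addrC [- L + k]addrC.
move=> s.
have dp : is_derive s 1 (fun s => F (s + L)) (f (s + L)).
  exact: is_derive_translate.
have dm : is_derive s 1 (fun s => F (s - L)) (f (s - L)).
  exact: is_derive_translate.
apply: is_derive_eq (is_deriveB dp dm) _.
have -> : s + L = (s - L) + 2 * L by ring.
by rewrite pf subrr.
Qed.

Lemma le_per_int (R : realType) (L : R) (f g : R -> R) :
  0 < L -> continuous f -> continuous g ->
  (forall x, f x <= g x) -> per_int L f <= per_int L g.
Proof.
move=> L0 cf cg fg; apply: le_Rintegral => //; exact: continuous_integrable.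
Qed.
(** By translation the integral over a period centred at z is also
    nonpositive, so a (nondecreasing) primitive is constant around z. *)
Lemma per_int_le0_eq0 (R : realType) (L : R) (f : R -> R) :
  0 < L -> continuous f -> periodic f (2 * L) -> (forall x, 0 <= f x) ->
  per_int L f <= 0 -> forall z, f z = 0.
Proof.
move=> L0 cf pf f0 If z; have [F dF] := exists_primitive cf.
have le_F x y : x <= y -> F x <= F y.
  by move=> xy; apply: (@is_derive_ge0_le _ F f).
have Fz : F (L + z) <= F (- L + z).
  rewrite -subr_le0; move: If.
  rewrite -(per_int_translate z L0 cf pf).
  have dFz (x : R) : is_derive x 1 (fun x => F (x + z)) (f (x + z)).
    exact: is_derive_translate.
  by rewrite (per_int_primitive L0 (continuous_translate cf) dFz).
have FzE x : `|z - x| < L -> F x = F z.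
  rewrite ltr_norml => /andP[h1 h2].
  have Fzx t : - L + z <= t -> t <= L + z -> F t = F (- L + z).
    move=> t1 t2; apply/le_anti; rewrite (le_F _ _ t1) andbT.
    exact: le_trans (le_F _ _ t2) Fz.
  by rewrite (Fzx x) ?(Fzx z)//; lra.
have dcst : is_derive z 1 F 0.
  apply: (@near_eq_is_derive _ _ _ (cst (F z))).
  near=> x; have zx : ball z L x by near: x; exact: nbhsx_ballx.
  by apply/esym/FzE.
by have [_ <-] := dF z; have [_ ->] := dcst.
Unshelve. all: by end_near. Qed.

(** * Poincare inequality *)

(** For theta < pi / (b - a) and T x = tan (theta (x - (a + b) / 2)),
<<
      Q'^2 - theta^2 Q^2 + (theta T Q^2)' = (Q' + theta T Q)^2 >= 0,
>>
    and the boundary term theta T Q^2 vanishes at a and b.  Staying strictly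
    below the optimal frequency keeps T regular on the closed interval; the
    optimal one is then reached by density. *)
Lemma dirichlet_wirtinger (R : realType) (Q dQ P G : R -> R) (a b : R) :
  a < b ->
  (forall x : R, is_derive x 1 Q (dQ x)) ->
  (forall x : R, is_derive x 1 P (Q x ^+ 2)) ->
  (forall x : R, is_derive x 1 G (dQ x ^+ 2)) ->
  Q a = 0 -> Q b = 0 ->
  (pi / (b - a)) ^+ 2 * (P b - P a) <= G b - G a.
Proof.
move=> ab dQE dP dG Qa Qb; set w := pi / (b - a).
have ba0 : 0 < b - a by rewrite subr_gt0.
have w0 : 0 < w by rewrite divr_gt0 ?pi_gt0.
have below theta : 0 < theta -> theta < w ->
    theta ^+ 2 * (P b - P a) <= G b - G a.
  move=> t0 tw; pose m := (a + b) / 2.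
  pose T x := tan (theta * (x - m)).
  have cos0 x : x \in `[a, b]%R -> cos (theta * (x - m)) != 0.
    rewrite in_itv/= => /andP[ax xb]; rewrite gt_eqF// cos_gt0_pihalf//.
    have tba : theta * (b - a) < pi by rewrite -ltr_pdivlMr.
    have xm1 : theta * (x - m) <= theta * ((b - a) / 2).
      by rewrite ler_pM2l// /m; lra.
    have xm2 : theta * (- ((b - a) / 2)) <= theta * (x - m).
      by rewrite ler_pM2l// /m; lra.
    apply/andP; split.
      by apply: lt_le_trans xm2; lra.
    by apply: le_lt_trans xm1 _; lra.
  have dT (x : R) : x \in `[a, b]%R ->
      is_derive x 1 T (theta * (1 + T x ^+ 2)).
    move=> /cos0 c0; have dl : is_derive x 1 (fun y => theta * (y - m)) theta.
      have dB : is_derive x 1 (fun y : R => y - m) 1.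
        by apply: is_derive_eq (is_deriveB _ _) _; rewrite subr0.
      by apply: is_derive_eq (is_deriveZ _ dB) _; rewrite /GRing.scale/= mulr1.
    have dt := is_derive_tan c0.
    apply: is_derive_eq
      (@is_derive1_comp R tan (fun y => theta * (y - m)) x _ _ dt dl) _.
    by rewrite cos2_tan2// mulrC.
  pose Phi := G - theta ^+ 2 *: P + theta *: (T * Q ^+ 2).
  have dPhi (x : R) : x \in `[a, b]%R ->
      is_derive x 1 Phi ((dQ x + theta * T x * Q x) ^+ 2).
    move=> xab; have ? := dT x xab.
    apply: is_derive_eq.
    rewrite !fctE /GRing.scale/= expr1; ring.
  have : Phi a <= Phi b.
    by apply: (is_derive_ge0_le dPhi (ltW ab)) => x _; exact: sqr_ge0.
  rewrite /Phi !fctE /GRing.scale/= Qa Qb; lra.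
have le_P : P a <= P b.
  by apply: (@is_derive_ge0_le _ P _ a b) (ltW ab) _ => // x _; exact: sqr_ge0.
have le_G : G a <= G b.
  by apply: (@is_derive_ge0_le _ G _ a b) (ltW ab) _ => // x _; exact: sqr_ge0.
rewrite leNgt; apply/negP => lt_w.
have P0 : 0 < P b - P a.
  rewrite lt_neqAle subr_ge0 le_P andbT eq_sym; apply/eqP => P0.
  by move: lt_w; rewrite P0 mulr0 ltNge subr_ge0 le_G.
pose s := Num.sqrt ((G b - G a) / (P b - P a)).
have s2 : s ^+ 2 = (G b - G a) / (P b - P a).
  by rewrite sqr_sqrtr// divr_ge0 ?subr_ge0.
have s0 : 0 <= s by exact: sqrtr_ge0.
have sw : s < w.
  by rewrite -(ltr_pXn2r (n:=2))// ?nnegrE ?ltW// s2 ltr_pdivrMr.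
have := below ((s + w) / 2) ltac:(lra) ltac:(lra).
rewrite -ler_pdivlMr// -s2 leNgt => /negP; apply.
by rewrite ltr_pXn2r// ?nnegrE//; lra.
Qed.

Lemma poincare (R : realType) (L : R) (Q dQ : R -> R) :
  0 < L -> continuous dQ -> (forall x : R, is_derive x 1 Q (dQ x)) ->
  Q (- L) = 0 -> Q 0 = 0 -> Q L = 0 ->
  per_int L (fun x => Q x ^+ 2) <=
  poincare_constant L * per_int L (fun x => dQ x ^+ 2).
Proof.
move=> L0 cdQ dQE QN Q0 QL.
have cQ := is_derive_continuous dQE.
have [P dP] := exists_primitive (continuous_sqr cQ).
have [G dG] := exists_primitive (continuous_sqr cdQ).
rewrite (per_int_primitive L0 (continuous_sqr cQ) dP).
rewrite (per_int_primitive L0 (continuous_sqr cdQ) dG).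
have NL0 : - L < 0 by rewrite oppr_lt0.
have := dirichlet_wirtinger L0 dQE dP dG Q0 QL.
have := dirichlet_wirtinger NL0 dQE dP dG QN Q0.
rewrite subr0 sub0r opprK => le1 le2.
rewrite /poincare_constant -expr_div_n -[_ / pi]invf_div exprVn.
rewrite mulrC ler_pdivlMr ?exprn_gt0 ?divr_gt0 ?pi_gt0// mulrC.
by move: le1 le2; set k := (pi / L) ^+ 2; lra.
Qed.

(** * Bounds on the lattice difference term *)

Lemma per_int_difference_le_sqr (R : realType) (L : R) (Q : R -> R) :
  0 < L -> continuous Q -> periodic Q (2 * L) ->
  per_int L (fun x => (Q (x + 1) - Q x) ^+ 2) <=
  4 * per_int L (fun x => Q x ^+ 2).
Proof.
move=> L0 cQ pQ.
have cQ1 := continuous_translate (k := 1) cQ.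
have [P dP] := exists_primitive (continuous_sqr cQ).
have dP1 (x : R) : is_derive x 1 (fun y => P (y + 1)) (Q (x + 1) ^+ 2).
  exact: is_derive_translate.
have psqr : periodic (fun x => Q x ^+ 2) (2 * L) by move=> x; rewrite pQ.
have := per_int_translate 1 L0 (continuous_sqr cQ) psqr.
rewrite (per_int_primitive L0 (continuous_sqr cQ1) dP1).
rewrite (per_int_primitive L0 (continuous_sqr cQ) dP) => PE.
pose F := 2 *: ((fun y => P (y + 1)) + P).
pose f x := 2 * (Q (x + 1) ^+ 2 + Q x ^+ 2).
have dF (x : R) : is_derive x 1 F (f x) by apply: is_derive_eq.
have cf : continuous f.
  move=> x; apply: cvgM; first exact: cvg_cst.
  by apply: cvgD; [exact: (continuous_sqr cQ1)|exact: (continuous_sqr cQ)].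
apply: (@le_trans _ _ (per_int L f)).
  apply: le_per_int => //.
    by apply: continuous_sqr => x; apply: cvgB; [exact: cQ1|exact: cQ].
  move=> x; rewrite /f -subr_ge0.
  suff -> : 2 * (Q (x + 1) ^+ 2 + Q x ^+ 2) - (Q (x + 1) - Q x) ^+ 2 =
      (Q (x + 1) + Q x) ^+ 2 by exact: sqr_ge0.
  ring.
rewrite (per_int_primitive L0 cf dF) /F !fctE /GRing.scale/=; lra.
Qed.

(** With G a primitive of dQ^2, the Cauchy-Schwarz inequality on [x, x + 1]
    bounds the integrand by G (x + 1) - G x.  The integral of G (x + 1) - G x
    over a period is a period integral of dQ^2: the derivative in s of
    int G (x + s) dx is G (L + s) - G (- L + s), which does not depend on s. *)
Lemma per_int_difference_le_deriv (R : realType) (L : R) (Q dQ : R -> R) :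
  0 < L -> continuous dQ -> (forall x : R, is_derive x 1 Q (dQ x)) ->
  periodic dQ (2 * L) ->
  per_int L (fun x => (Q (x + 1) - Q x) ^+ 2) <=
  per_int L (fun x => dQ x ^+ 2).
Proof.
move=> L0 cdQ dQE pdQ.
have cQ := is_derive_continuous dQE.
have [G dG] := exists_primitive (continuous_sqr cdQ).
have cG := is_derive_continuous dG.
have [H dH] := exists_primitive cG.
have cauchy x : (Q (x + 1) - Q x) ^+ 2 <= G (x + 1) - G x.
  (* Cauchy-Schwarz as int (dQ - d)^2 >= 0, with d the mean of dQ. *)
  pose d := Q (x + 1) - Q x.
  pose F := G - (2 * d) *: Q + d ^+ 2 *: id.
  have dF (y : R) : is_derive y 1 F ((dQ y - d) ^+ 2).
    by apply: is_derive_eq; rewrite /GRing.scale/=; ring.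
  have : F x <= F (x + 1).
    apply: (@is_derive_ge0_le _ F (fun y => (dQ y - d) ^+ 2)) => //.
      by rewrite lerDl.
    by move=> y _; exact: sqr_ge0.
  rewrite /F !fctE /GRing.scale/= => le_F; rewrite -/d -subr_ge0.
  have <- : G (x + 1) - 2 * d * Q (x + 1) + d ^+ 2 * (x + 1)
    - (G x - 2 * d * Q x + d ^+ 2 * x) = G (x + 1) - G x - d ^+ 2.
    by rewrite [in RHS]/d /d; ring.
  by rewrite subr_ge0.
have dH1 (x : R) : is_derive x 1 (fun y : R => H (y + 1)) (G (x + 1)).
  exact: is_derive_translate.
have dD (x : R) :
    is_derive x 1 ((fun y : R => H (y + 1)) - H) (G (x + 1) - G x).
  exact: is_deriveB.
have cD : continuous (fun x : R => G (x + 1) - G x).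
  by move=> x; apply: cvgB; [exact: continuous_translate|exact: cG].
apply: (@le_trans _ _ (per_int L (fun x => G (x + 1) - G x))).
  apply: le_per_int => //; apply: continuous_sqr => x.
  by apply: cvgB; [exact: continuous_translate|exact: cQ].
rewrite (per_int_primitive L0 cD dD) !fctE.
set A := per_int L _.
pose W := (fun s => H (s + L)) - (fun s => H (s - L)) - A *: id.
have dW (s : R) : is_derive s 1 W 0.
  have dHp : is_derive s 1 (fun s => H (s + L)) (G (s + L)).
    exact: is_derive_translate.
  have dHm : is_derive s 1 (fun s => H (s - L)) (G (s - L)).
    exact: is_derive_translate.
  apply: is_derive_eq; rewrite /GRing.scale/= mulr1.
  have dGs (x : R) : is_derive x 1 (fun y => G (y + s)) (dQ (x + s) ^+ 2).
    exact: is_derive_translate.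
  have psqr : periodic (fun x => dQ x ^+ 2) (2 * L) by move=> x; rewrite pdQ.
  have := per_int_translate s L0 (continuous_sqr cdQ) psqr.
  rewrite (@per_int_primitive _ _ (fun y => G (y + s)))//; last first.
    exact/continuous_sqr/continuous_translate.
  by rewrite -/A [L + s]addrC [- L + s]addrC => ->; rewrite subrr.
have := is_derive_0_eq dW 1 0.
rewrite /W !fctE /GRing.scale/= !add0r.
by rewrite [1 + L]addrC [1 - L]addrC; lra.
Qed.
(** * Travelling waves as classical solutions *)

(** The set where a continuous Q exceeds M is open, so if it meets ]-L, L[ it
    contains a ball of positive measure. *)
Lemma Linfty_norm_pointwise (R : realType) (L M : R) (Q : R -> R) :
  continuous Q -> (Linfty_norm L Q <= M%:E)%E ->
  forall x : R, x \in `]- L, L[%R -> `|Q x| <= M.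
Proof.
move=> cQ; rewrite /Linfty_norm unlock; set mu := mrestr _ _ => + x xL.
have LL : - L < L.
  by move: xL; rewrite in_itv/= => /andP[h1 h2]; exact: lt_trans h1 h2.
have -> : (0 < mu [set: R])%E.
  rewrite /mu /= /mrestr setTI lebesgue_measure_itv/= lte_fin LL.
  by rewrite lte_fin subr_gt0.
move=> /ess_sup_inf.ess_supP [N [mN N0 sN]]; rewrite leNgt; apply/negP => Mx.
have oQ : open [set y | M < `|Q y|].
  apply: (@open_comp _ _ (fun y => `|Q y|) [set y | M < y]);
    last exact: open_gt.
  by move=> y _; apply: (@continuous_comp _ _ _ Q);
    [exact: cQ|exact: norm_continuous].
have oU : open ([set y | M < `|Q y|] `&` `]- L, L[).
  by apply: openI => //; exact: interval_open.
have [e /= e0 eU] : nbhs_ball x ([set y | M < `|Q y|] `&` `]- L, L[).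
  by apply/nbhs_ballP; apply: open_nbhs_nbhs; split.
have : (lebesgue_measure (ball x e) <= 0)%E.
  rewrite -N0; apply: le_measure; rewrite ?inE//.
  - exact: measurable_realfun.measurable_ball.
  - exact: measurableI.
  - move=> y /eU[My yL]; split => //.
    by apply: sN => /=; rewrite lee_fin leNgt My.
rewrite lebesgue_measure_ball ?(ltW e0)//. 
by rewrite -[X in (_ <= X)%E]/(0%:E) lee_fin leNgt pmulrn_lgt0// e0.
Qed.

Lemma classical_weak_derivative (R : realType) (L : R) (Q dQ : R -> R) :
  0 < L -> periodic Q (2 * L) ->
  continuous dQ -> (forall x : R, is_derive x 1 Q (dQ x)) ->
  weak_derivative L Q dQ.
Proof.
move=> L0 pQ cdQ dQE; split.
  split.
    apply: measurable_funTS.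
    exact: measurable_realfun.continuous_measurable_fun.
  by apply: continuous_integrable; exact: continuous_sqr.
move=> phi sphi pphi.
have cQ := is_derive_continuous dQE.
have dphi (x : R) : is_derive x 1 phi (phi^`()%classic x).
  by rewrite derive1E; apply/derivableP; exact: (sphi 0 x).
have cphi := is_derive_continuous dphi.
have cphi' : continuous (phi^`()%classic).
  move=> x; apply: differentiable_continuous; apply/derivable1_diffP.
  exact: (sphi 1 x).
have cQphi' : continuous (fun x => Q x * phi^`()%classic x).
  by move=> x; apply: cvgM; [exact: cQ|exact: cphi'].
have cQ'phi : continuous (fun x => dQ x * phi x).
  by move=> x; apply: cvgM; [exact: cdQ|exact: cphi].
have [K dK] := exists_primitive cQphi'.
have dB (x : R) : is_derive x 1 (Q * phi - K) (dQ x * phi x).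
  by apply: is_derive_eq; rewrite /GRing.scale/=; ring.
rewrite (per_int_primitive L0 cQphi' dK) (per_int_primitive L0 cQ'phi dB).
rewrite !fctE.
have LE : L = - L + 2 * L by ring.
have -> : Q L = Q (- L) by rewrite {1}LE pQ.
have -> : phi L = phi (- L) by rewrite {1}LE pphi.
ring.
Qed.

Lemma periodic_is_derive (R : realType) (T : R) (f df : R -> R) :
  (forall x : R, is_derive x 1 f (df x)) -> periodic f T -> periodic df T.
Proof.
move=> dfE pf x; have dfT := is_derive_translate (dfE (x + T)).
have fT : (fun y => f (y + T)) = f by apply/funext => y; rewrite pf.
rewrite fT in dfT.
by have [_ <-] := dfT; have [_ <-] := dfE x.
Qed.

Lemma soft_potential_derive (R : realType) (omega0 a : R) (p : nat) (x : R) :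
  (soft_potential omega0 a p)^`()%classic x =
  - omega0 ^+ 2 * x + a * x ^+ p.
Proof.
rewrite derive1E.
have -> : soft_potential omega0 a p =
    (- (omega0 ^+ 2 / 2)) *: (id ^+ 2) + (a / (p%:R + 1)) *: (id ^+ p.+1).
  by apply/funext => y; rewrite /soft_potential !fctE.
rewrite derive_val /GRing.scale/= mulr1 expr1 -natr1.
field.
by rewrite gt_eqF// ltr_wpDl.
Qed.

(** The particle n = 0 moves as q_0 t = Q (- c t), which for c != 0 can be
    solved for Q, so the derivatives of q_0 carry over to Q. *)
Lemma travelling_wave_profile (R : realType) (kappa c : R) (V Q : R -> R) :
  c != 0 -> lattice_solution kappa V (fun n t => Q (n%:~R - c * t)) ->
  exists dQ ddQ : R -> R,
  [/\ forall x : R, is_derive x 1 Q (dQ x),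
      forall x : R, is_derive x 1 dQ (ddQ x)
    & forall z, c ^+ 2 * ddQ z =
        kappa * (Q (z + 1) - 2 * Q z + Q (z - 1)) - V^`()%classic (Q z)].
Proof.
move=> c0 sol; pose q t := Q (0%:~R - c * t).
pose k := - c^-1.
have dk (x : R) : is_derive x 1 (fun y => k * y) k.
  by apply: is_derive_eq (is_deriveZ _ (is_derive_id _ _)) _;
    rewrite /GRing.scale/= mulr1.
have kc z : c * (k * z) = - z by rewrite /k; field.
exists (fun z => k * q^`()%classic (k * z)).
exists (fun z => k ^+ 2 * q^`(2)%classic (k * z)); split => z.
- have [dq _ _] := sol 0 (k * z).
  have dqE : is_derive (k * z) 1 q (q^`()%classic (k * z)).
    by rewrite derive1E; exact/derivableP.
  have -> : Q = q \o (fun y => k * y).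
    by apply/funext => y; rewrite /q/= kc sub0r opprK.
  by apply: is_derive_eq (is_derive1_comp dqE (dk z)) _; rewrite mulrC.
- have [_ ddq _] := sol 0 (k * z).
  have dqE : is_derive (k * z) 1 (q^`()%classic) (q^`(2)%classic (k * z)).
    by rewrite derive1nS/= derive1E; exact/derivableP.
  apply: is_derive_eq (is_deriveZ k (is_derive1_comp dqE (dk z))) _.
  by rewrite /GRing.scale/=; ring.
- have [_ _] := sol 0 (k * z); rewrite -/q kc add0r sub0r !opprK.
  rewrite [1%:~R + z]addrC [-1 + z]addrC => <-.
  by rewrite mulrA -exprMn /k mulrN divff// sqrrN expr1n mul1r.
Qed.
(** * Energy estimate and the threshold *)

(** Summation by parts: with m x = Q x (Q x - Q (x - 1)),
<<
      Q x (Q (x+1) - 2 Q x + Q (x-1))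
        = - (Q (x+1) - Q x)^2 + (m (x+1) - m x),
>>
    and the last difference integrates to zero over a period.  So Psi below,
    built from primitives, increases over the period by the difference of the
    two sides, and its derivative psi collects the terms of the on-site force,
    which are nonnegative because Q^(p-1) <= M^(p-1). *)
Lemma energy_estimate (R : realType) (L c kappa omega0 a M : R) (p : nat)
    (Q dQ ddQ : R -> R) :
  0 < L -> 0 <= a -> 0 <= M -> (0 < p)%N ->
  (forall x : R, is_derive x 1 Q (dQ x)) ->
  (forall x : R, is_derive x 1 dQ (ddQ x)) ->
  (forall z, c ^+ 2 * ddQ z =
     kappa * (Q (z + 1) - 2 * Q z + Q (z - 1))
     - (- omega0 ^+ 2 * Q z + a * Q z ^+ p)) ->
  periodic Q (2 * L) ->
  (forall x : R, x \in `]- L, L[%R -> `|Q x| <= M) ->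
  c ^+ 2 * per_int L (fun x => dQ x ^+ 2) <=
  kappa * per_int L (fun x => (Q (x + 1) - Q x) ^+ 2)
  + a * M ^+ (p - 1) * per_int L (fun x => Q x ^+ 2).
Proof.
move=> L0 a0 M0 p0 dQE ddQE eqQ pQ QM.
have cQ := is_derive_continuous dQE.
have cdQ := is_derive_continuous ddQE.
have pdQ := periodic_is_derive dQE pQ.
have cD : continuous (fun x : R => Q (x + 1) - Q x).
  by move=> x; apply: cvgB; [exact: continuous_translate|exact: cQ].
pose m x := Q x * (Q x - Q (x - 1)).
have cm : continuous m.
  move=> x; apply: cvgM; first exact: cQ.
  by apply: cvgB; [exact: cQ|exact: (continuous_translate (k := - 1))].
have pm : periodic m (2 * L).
  by move=> x; rewrite /m addrAC !pQ.
have [G dG] := exists_primitive (continuous_sqr cdQ).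
have [P dP] := exists_primitive (continuous_sqr cQ).
have [J dJ] := exists_primitive (continuous_sqr cD).
have [W dW] := exists_primitive cm.
have dW1 (x : R) : is_derive x 1 (fun y => W (y + 1)) (m (x + 1)).
  exact: is_derive_translate.
have := per_int_translate 1 L0 cm pm.
rewrite (per_int_primitive L0 (continuous_translate cm) dW1).
rewrite (per_int_primitive L0 cm dW) => WE.
rewrite (per_int_primitive L0 (continuous_sqr cdQ) dG).
rewrite (per_int_primitive L0 (continuous_sqr cQ) dP).
rewrite (per_int_primitive L0 (continuous_sqr cD) dJ).
set B := a * M ^+ (p - 1).
pose Psi := c ^+ 2 *: (Q * dQ) - kappa *: ((fun y : R => W (y + 1)) - W)
  + kappa *: J + B *: P - c ^+ 2 *: G.
pose psi x := omega0 ^+ 2 * Q x ^+ 2 + (B - a * Q x ^+ (p - 1)) * Q x ^+ 2.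
have dPsi (x : R) : is_derive x 1 Psi (psi x).
  apply: is_derive_eq; rewrite /GRing.scale/= /psi /m.
  have -> : c ^+ 2 * (Q x * ddQ x + dQ x * dQ x) =
    Q x * (c ^+ 2 * ddQ x) + c ^+ 2 * dQ x ^+ 2 by ring.
  have pE : p = (p - 1).+1 by rewrite subn1 prednK.
  have -> : x + 1 - 1 = x by ring.
  have QpE : Q x ^+ p = Q x * Q x ^+ (p - 1) by rewrite -exprS -pE.
  by rewrite eqQ QpE; ring.
have psi0 x : x \in `]- L, L[%R -> 0 <= psi x.
  move=> /QM Qx; rewrite /psi addr_ge0//.
    by rewrite -exprMn sqr_ge0.
  rewrite mulr_ge0 ?sqr_ge0// /B -mulrBr mulr_ge0// subr_ge0.
  by rewrite (le_trans (ler_norm _))// normrX lerXn2r// nnegrE.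
have : Psi (- L) <= Psi L.
  by apply: (is_derive_ge0_le (f := psi)) => //; rewrite ge0_cp// ltW.
have LE : L = - L + 2 * L by ring.
have QE : Q L = Q (- L) by rewrite {1}LE pQ.
have dQLE : dQ L = dQ (- L) by rewrite {1}LE pdQ.
rewrite /Psi !fctE /GRing.scale/= QE dQLE.
have : kappa * (W (L + 1) - W L) = kappa * (W (- L + 1) - W (- L)).
  by congr (_ * _); lra.
lra.
Qed.

Theorem mainTheorem5 (R : realType) (kappa L omega0 a : R) (p : nat)
    (hkappa : 0 < kappa) (hL : 0 < L) (ha : 0 < a)
    (hp : (1 < p)%N) (hodd : odd p)
    (Cs : R)
    (hCs : optimal_embedding_constant (soft_potential omega0 a p) L Cs)
    (c : R) (hc : c_crit_sq kappa omega0 L < c ^+ 2)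
    (Q : R -> R)
    (hQ : periodic_travelling_wave kappa (soft_potential omega0 a p) L c Q)
    (hQ0 : exists z, Q z != 0) :
  T_thresh kappa omega0 a p L c Cs < 2 * kinetic_energy L Q.
Proof.
have [hX hsol] := hQ; have [[cQ pQ _] _ _ hsym] := hX.
have [Cs0 hemb _] := hCs.
set r := L / pi.
have r0 : 0 < r by rewrite divr_gt0 ?pi_gt0.
have CE : poincare_constant L = r ^+ 2 by rewrite /poincare_constant expr_div_n.
have ccritE : c_crit_sq kappa omega0 L =
    r * (2 * kappa + r ^+ 2 * omega0 ^+ 2).
  by rewrite /c_crit_sq CE sqrtr_sqr gtr0_norm.
have ccrit_ge : 2 * kappa * r <= c_crit_sq kappa omega0 L.
  rewrite ccritE mulrDr [r * _]mulrC lerDl mulr_ge0 ?(ltW r0)//.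
  by rewrite -exprMn sqr_ge0.
have c0 : c != 0.
  apply: contraTneq hc => ->; rewrite expr0n/= -leNgt.
  apply: le_trans ccrit_ge; rewrite mulr_ge0 ?(ltW r0)//.
  by rewrite mulr_ge0// ltW.
have [dQ [ddQ [dQE ddQE eqQ]]] := travelling_wave_profile c0 hsol.
have cdQ := is_derive_continuous ddQE.
have odd_Q u : Q (- u) = - Q u.
  have := hsym (L / 2 - u); rewrite opprB addrCA subrr addr0 => <-.
  by congr Q; ring.
have Q0 : Q 0 = 0 by have := odd_Q 0; rewrite oppr0; lra.
have QL : Q L = 0.
  have := pQ (- L); rewrite (_ : - L + 2 * L = L); last by ring.
  by rewrite odd_Q; lra.
have QNL : Q (- L) = 0 by rewrite odd_Q QL oppr0.
set A := per_int L (fun x => dQ x ^+ 2).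
have TE : 2 * kinetic_energy L Q = A.
  have -> : A = per_int L (fun z => (Q^`()%classic) z ^+ 2).
    rewrite /A; congr (per_int L _); apply/funext => z.
    by rewrite derive1E; have [_ ->] := dQE z.
  by rewrite /kinetic_energy mulrA divff ?mul1r.
set S := per_int L (fun x => Q x ^+ 2).
set D := per_int L (fun x => (Q (x + 1) - Q x) ^+ 2).
have SA : S <= r ^+ 2 * A by rewrite -CE; exact: poincare.
have DS : D <= 4 * S by exact: per_int_difference_le_sqr.
have DA : D <= A.
  apply: per_int_difference_le_deriv => //.
  exact: periodic_is_derive dQE pQ.
have A0 : 0 < A.
  rewrite ltNge; apply/negP => A0; have [z] := hQ0.
  suff /eqP : Q z ^+ 2 = 0 by rewrite sqrf_eq0 => /eqP ->; rewrite eqxx.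
  apply: (per_int_le0_eq0 hL (continuous_sqr cQ)) => [x|x|].
  - by rewrite pQ.
  - exact: sqr_ge0.
  - by rewrite (le_trans SA)// pmulr_rle0// exprn_gt0.
pose M := Cs * Num.sqrt A.
have M0 : 0 < M by rewrite mulr_gt0// sqrtr_gt0.
have QM (x : R) : x \in `]- L, L[%R -> `|Q x| <= M.
  apply: Linfty_norm_pointwise => //; apply: hemb => //.
  exact: classical_weak_derivative.
pose B := a * M ^+ (p - 1).
have B0 : 0 < B by rewrite mulr_gt0// exprn_gt0.
have eqQ' z : c ^+ 2 * ddQ z = kappa * (Q (z + 1) - 2 * Q z + Q (z - 1))
    - (- omega0 ^+ 2 * Q z + a * Q z ^+ p).
  by rewrite eqQ soft_potential_derive.
have := energy_estimate hL (ltW ha) (ltW M0) (ltnW hp) dQE ddQE eqQ' pQ QM.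
rewrite -/A -/D -/S -/B => energy.
(* Interpolate between D <= A and D <= 4 r^2 A. *)
have DrA : D <= 2 * r * A.
  have [r1|r1] := leP 1 (2 * r).
    by apply: le_trans DA _; rewrite ler_peMl// ltW.
  apply: le_trans DS _; apply: (@le_trans _ _ (4 * (r ^+ 2 * A))).
    by rewrite ler_pM2l.
  rewrite mulrA ler_pM2r//; nra.
have c2_le : c ^+ 2 <= 2 * kappa * r + B * r ^+ 2.
  rewrite -(ler_pM2r A0); apply: le_trans energy _.
  rewrite mulrDl; apply: lerD.
    by rewrite -(mulrA 2) mulrCA -mulrA ler_pM2l// mulrA.
  by rewrite -(mulrA B) ler_pM2l.
rewrite TE /T_thresh CE.
set X := _ / r ^+ 2; set Y := 1 / _; set s := 2 / _.
have X0 : 0 < X by rewrite divr_gt0 ?exprn_gt0 ?subr_gt0.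
have XB : X <= B by rewrite ler_pdivrMr ?exprn_gt0//; lra.
have p0 : 0 < p%:R :> R by rewrite ltr0n ltnW.
have Y0 : 0 < Y by rewrite divr_gt0 ?mulr_gt0 ?exprn_gt0.
have p1 : 1 < p%:R :> R by rewrite ltr1n.
have s0 : 0 < s by rewrite divr_gt0 ?subr_gt0.
have XY : X * Y < Num.sqrt A ^+ (p - 1).
  rewrite mulrA mulr1 ltr_pdivrMr ?mulr_gt0 ?exprn_gt0//.
  apply: le_lt_trans XB _.
  have -> : Num.sqrt A ^+ (p - 1) * (p%:R * a * Cs ^+ (p - 1)) = p%:R * B.
    by rewrite /B /M exprMn; ring.
  by rewrite ltr_pMl.
rewrite -powRM ?(ltW X0) ?(ltW Y0)//.
have -> : A = (Num.sqrt A ^+ (p - 1)) `^ s.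
  rewrite -powR_mulrn ?sqrtr_ge0// -powRrM natrB ?(ltnW hp)//.
  rewrite /s mulrC divfK ?subr_eq0 ?gt_eqF//.
  by rewrite powR_mulrn ?sqrtr_ge0// sqr_sqrtr// ltW.
apply: gt0_ltr_powR => //.
  by rewrite nnegrE ltW// mulr_gt0.
by rewrite nnegrE exprn_ge0// sqrtr_ge0.
Qed.
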